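(* Let $X$ be a finite dimensional linear $n$-normed space over $\mathbb{K}$ and let $b_2,\dots,b_n\in X$ be fixed elements. Then $b$-weak convergence implies $b$-strong convergence in $X$: if a sequence $\{x_k\}$ in $X$ converges $b$-weakly to $x\in X$, then $\{x_k\}$ converges $b$-strongly to $x$.
   Context: Let $n$ be a positive integer and let $X$ be a linear space over $\mathbb{K}$ ($=\mathbb{R}$ or $\mathbb{C}$) with $\dim X\ge n$. An $n$-norm on $X$ is a function $\|\cdot,\dots,\cdot\|:X^n\to\mathbb{R}$ such that: (N1) $\|x_1,\dots,x_n\|=0$ if and only if $x_1,\dots,x_n$ are linearly dependent; (N2) $\|x_1,\dots,x_n\|$ is invariant under permutations of $x_1,\dots,x_n$; (N3) $\|\alpha x_1,x_2,\dots,x_n\|=|\alpha|\,\|x_1,x_2,\dots,x_n\|$ for all $\alpha\in\mathbb{K}$; (N4) $\|x+y,x_2,\dots,x_n\|\le\|x,x_2,\dots,x_n\|+\|y,x_2,\dots,x_n\|$. The pair $(X,\|\cdot,\dots,\cdot\|)$ is a linear $n$-normed space. Fix $b_2,\dots,b_n\in X$ and let $\langle b_i\rangle$ be the subspace generated by $b_i$. A $b$-linear functional on $X\times\langle b_2\rangle\times\cdots\times\langle b_n\rangle$ is a map $T:X\times\langle b_2\rangle\times\cdots\times\langle b_n\rangle\to\mathbb{K}$ with $T(x+y,b_2,\dots,b_n)=T(x,b_2,\dots,b_n)+T(y,b_2,\dots,b_n)$ and $T(kx,b_2,\dots,b_n)=k\,T(x,b_2,\dots,b_n)$ for all $x,y\in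 X$, $k\in\mathbb{K}$. It is bounded if there is $M>0$ with $|T(x,b_2,\dots,b_n)|\le M\|x,b_2,\dots,b_n\|$ for all $x\in X$. $X_F^{*}$ denotes the set of all bounded $b$-linear functionals on $X\times\langle b_2\rangle\times\cdots\times\langle b_n\rangle$. A sequence $\{x_k\}$ in $X$ converges $b$-weakly to $x\in X$ if $\lim_{k\to\infty}T(x_k,b_2,\dots,b_n)=T(x,b_2,\dots,b_n)$ for every $T\in X_F^{*}$; it converges $b$-strongly to $x$ if $\lim_{k\to\infty}\|x_k-x,b_2,\dots,b_n\|=0$. *)

(* Defs.v *)
From HB Require Import structures.
From mathcomp Require Import all_boot all_order all_algebra.
From mathcomp Require Import complex.
From mathcomp Require Import all_classical all_reals all_analysis.

Set Implicit Arguments.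
Unset Strict Implicit.
Unset Printing Implicit Defensive.

Import Order.TTheory GRing.Theory Num.Theory.
Import numFieldNormedType.Exports.

Local Open Scope classical_set_scope.
Local Open Scope ring_scope.

Variant scalar_kind := RealScalars | ComplexScalars.

Definition scalars (R : realType) (k : scalar_kind) : numFieldType :=
  match k with
  | RealScalars => R
  | ComplexScalars => R[i]
  end.

(* MathComp's norm on [R[i]] takes its values in [R[i]]; the modulus here is
   [R]-valued in both cases. *)
Definition modulus (R : realType) (k : scalar_kind) : scalars R k -> R :=
  match k return scalars R k -> R with
  | RealScalars => fun a => `|a|
  | ComplexScalars => fun a => Normc.normc a
  end.

(* The arity [n] of the n-norm is [m.+1], so that a tuple can be written as a
   first vector followed by an [m]-tuple; [b : m.-tuple X] below stands for
   (b_2, ..., b_n). *)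
Record is_nnorm (R : realType) (k : scalar_kind) (X : vectType (scalars R k))
    (m : nat) (N : m.+1.-tuple X -> R) : Prop := IsNNorm {
  nnorm_eq0 : forall u : m.+1.-tuple X, N u = 0 <-> ~~ free u;
  nnorm_perm : forall u v : m.+1.-tuple X, perm_eq u v -> N u = N v;
  nnormZ : forall (a : scalars R k) (x : X) (u : m.-tuple X),
    N [tuple of a *: x :: u] = modulus a * N [tuple of x :: u];
  ler_nnormD : forall (x y : X) (u : m.-tuple X),
    N [tuple of x + y :: u] <= N [tuple of x :: u] + N [tuple of y :: u]
}.

Section BLinear.
Variables (R : realType) (k : scalar_kind) (X : vectType (scalars R k)).
Variables (m : nat) (N : m.+1.-tuple X -> R) (b : m.-tuple X).

Definition bdomain : Type :=
  (X * (forall i : 'I_m, subvs_of <[tnth b i]>%VS))%type.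

Definition bpoint (x : X) : bdomain :=
  (x, fun i => Subvs (memv_line (tnth b i))).

Definition b_linear (T : bdomain -> scalars R k) : Prop :=
  (forall x y : X, T (bpoint (x + y)) = T (bpoint x) + T (bpoint y)) /\
  (forall (a : scalars R k) (x : X), T (bpoint (a *: x)) = a * T (bpoint x)).

Definition b_bounded (T : bdomain -> scalars R k) : Prop :=
  exists2 M : R, 0 < M &
    forall x : X, modulus (T (bpoint x)) <= M * N [tuple of x :: b].

Definition b_dual : set (bdomain -> scalars R k) :=
  [set T | b_linear T /\ b_bounded T].

Definition b_weak_cvg (x_ : nat -> X) (x : X) : Prop :=
  forall T, b_dual T -> T (bpoint (x_ j)) @[j --> \oo] --> T (bpoint x).

Definition b_strong_cvg (x_ : nat -> X) (x : X) : Prop :=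
  N [tuple of x_ j - x :: b] @[j --> \oo] --> (0 : R).

End BLinear.

Arguments b_dual {R k X m} N b _.

(* Main.v *)
Require Import Defs.
From mathcomp Require Import all_boot all_order all_algebra.
From mathcomp Require Import all_classical all_reals all_analysis.
From mathcomp Require Import complex.

(** The map p x = ||x, b_2, ..., b_n|| is a seminorm on X.  If b_2, ..., b_n are
    dependent it vanishes identically and there is nothing to prove.  Otherwise
    its null space is exactly U, the span of the b_i, so p is a norm on any
    complement of U; let e be a basis of such a complement.  On a
    finite-dimensional space every norm dominates the coordinates
    ([coef_le_seminorm]); composing the coordinates along e with the projection
    that kills U therefore gives bounded b-linear functionals T_i on X.
    Since p (y) <= \sum_i |T_i y| p (e_i), weak convergence, tested on the
    finitely many T_i only, forces p (x_j - x) --> 0.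

    The domination of coordinates is proved by induction on the number of
    vectors, for real and complex scalars at once.  The main analytic input is
    completeness of the scalars, used for sequences with an explicit Cauchy rate
    1 / (j + 1) ([modulus_complete]): if the new vector were at p-distance 0 from
    the span of the previous ones, the coefficients of better and better
    approximations would converge, and their limit would be a nontrivial
    combination of p-value 0. *)

Set Implicit Arguments.
Unset Strict Implicit.
Unset Printing Implicit Defensive.

Import Order.TTheory GRing.Theory Num.Theory.
Import numFieldNormedType.Exports.

Local Open Scope classical_set_scope.
Local Open Scope ring_scope.

(** * The modulus on the scalars *)

Section Modulus.
Context {R : realType} {k : scalar_kind}.
Implicit Types a : scalars R k.

Lemma modulus_ge0 a : 0 <= modulus a.
Proof.
case: k a => a /=; first exact: normr_ge0.
by case: a => x y; exact: sqrtr_ge0.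
Qed.

Lemma modulus0 : modulus (0 : scalars R k) = 0.
Proof. by case: k => /=; [exact: normr0 | exact: Normc.normc0]. Qed.

Lemma modulusN a : modulus (- a) = modulus a.
Proof. by case: k a => a /=; [exact: normrN | exact: normcN]. Qed.

(** The topology of the complex scalars is defined by their own C-valued norm;
    this transfers convergence to the real-valued modulus. *)
Lemma cvg_modulus (u : nat -> scalars R k) (l : scalars R k) :
  u j @[j --> \oo] --> l -> modulus (u j - l) @[j --> \oo] --> (0 : R).
Proof.
have mE j : `|0 - modulus (u j - l)| = modulus (l - u j).
  by rewrite sub0r normrN ger0_norm ?modulus_ge0// -modulusN opprB.
move=> ul; apply/cvgrPdist_lt => e e0.
under eq_near do rewrite mE.
case: k u l {mE} ul => u l ul; first by move/cvgrPdist_lt : ul; apply.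
have e0' : (0 : R[i]) < (e%:C)%C by rewrite ltcR.
move/cvgrPdist_lt : ul => /(_ _ e0'); apply: filterS => j.
by rewrite -[ltLHS]/((Normc.normc (l - u j))%:C)%C ltcR.
Qed.

End Modulus.

(** * Completeness with an explicit rate *)

(** The intervals of radius C / (j + 1) around u j meet pairwise, hence the
    supremum of their left ends lies in all of them. *)
Lemma real_complete_rate (R : realType) (u : nat -> R) (C : R) :
  (forall i j, `|u i - u j| <= C * (i.+1%:R^-1 + j.+1%:R^-1)) ->
  exists l, forall j, `|u j - l| <= C * j.+1%:R^-1.
Proof.
move=> uC; pose A := range (fun j => u j - C * j.+1%:R^-1).
have Aub j : ubound A (u j + C * j.+1%:R^-1).
  move=> _ [i _ <-]; have := uC i j; rewrite ler_norml => /andP[_].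
  by rewrite mulrDr lerBlDr lerBlDl addrA addrAC.
have A0 : A !=set0 by exists (u 0%N - C * 1%:R^-1), 0%N.
exists (sup A) => j; rewrite ler_distl lerBlDr -[X in _ && X]lerBlDr.
apply/andP; split; first by apply: sup_le_ub => //; exact: Aub.
apply: sup_upper_bound; last by exists j.
by split=> //; exists (u 0%N + C * 1%:R^-1); exact: Aub.
Qed.

(** The factor 2 comes from adding up the errors on the real and imaginary
    parts in the complex case. *)
Lemma modulus_complete (R : realType) (k : scalar_kind)
    (u : nat -> scalars R k) (C : R) :
  (forall i j, modulus (u i - u j) <= C * (i.+1%:R^-1 + j.+1%:R^-1)) ->
  exists l, forall j, modulus (u j - l) <= 2 * C * j.+1%:R^-1.
Proof.
case: k u => u uC.
  have [l ul] := real_complete_rate uC; exists l => j.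
  apply: (le_trans (ul j)); rewrite -mulrA ler_peMl ?ler1n//.
  exact: le_trans (ul j).
have part_le (z : R[i]) : `|complex.Re z| <= Normc.normc z /\
    `|complex.Im z| <= Normc.normc z.
  case: z => x y /=; rewrite -!sqrtr_sqr.
  by split; apply: ler_wsqrtr; rewrite ?lerDl ?lerDr sqr_ge0.
have le_part (z : R[i]) : Normc.normc z <= `|complex.Re z| + `|complex.Im z|.
  case: z => x y /=; rewrite -[leRHS]ger0_norm ?addr_ge0// -sqrtr_sqr.
  apply: ler_wsqrtr; rewrite sqrrD !real_normK ?num_real//.
  by rewrite -addrA [_ *+ 2 + _]addrC addrA lerDl mulrn_wge0 ?mulr_ge0.
have Re_sub (z w : R[i]) : complex.Re (z - w) = complex.Re z - complex.Re w.
  by case: z w => [? ?] [? ?].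
have Im_sub (z w : R[i]) : complex.Im (z - w) = complex.Im z - complex.Im w.
  by case: z w => [? ?] [? ?].
have [|x ux] := @real_complete_rate R (fun j => complex.Re (u j)) C.
  move=> i j /=; rewrite -Re_sub.
  exact: le_trans (part_le _).1 (uC i j).
have [|y uy] := @real_complete_rate R (fun j => complex.Im (u j)) C.
  move=> i j /=; rewrite -Im_sub.
  exact: le_trans (part_le _).2 (uC i j).
exists (x +i* y)%C => j; apply: (le_trans (le_part _)).
rewrite Re_sub Im_sub /= -mulrA mulr2n mulrDl mul1r.
exact: lerD (ux j) (uy j).
Qed.

Lemma le0_of_le_harmonic (R : realType) (a C : R) :
  (forall j, a <= C * j.+1%:R^-1) -> a <= 0.
Proof.
move=> aC; rewrite leNgt; apply/negP => a0.
have := aC (Num.truncn (C / a)).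
rewrite ler_pdivlMr ?ltr0n// leNgt mulrC.
by rewrite -ltr_pdivrMr// truncnS_gt.
Qed.

(** * Seminorms dominate coordinates *)

Record is_seminorm (R : realType) (k : scalar_kind) (X : lmodType (scalars R k))
    (p : X -> R) : Prop := IsSeminorm {
  seminormZ : forall (a : scalars R k) (x : X), p (a *: x) = modulus a * p x;
  ler_seminormD : forall x y : X, p (x + y) <= p x + p y
}.

Section Seminorm.
Context {R : realType} {k : scalar_kind} {X : lmodType (scalars R k)}.
Variable p : X -> R.
Hypothesis hp : is_seminorm p.

Lemma seminorm0 : p 0 = 0.
Proof. by rewrite -(scale0r (0 : X)) (seminormZ hp) modulus0 mul0r. Qed.

Lemma seminormN x : p (- x) = p x.
Proof.
rewrite -scaleN1r (seminormZ hp) modulusN.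
suff -> : modulus (1 : scalars R k) = 1 by rewrite mul1r.
by case: k => /=; [exact: normr1 | exact: Normc.normc1].
Qed.

Lemma seminorm_ge0 x : 0 <= p x.
Proof.
have := ler_seminormD hp x (- x); rewrite subrr seminorm0 seminormN.
by rewrite -mulr2n pmulrn_lge0.
Qed.

Lemma ler_seminorm_sum d (a : 'I_d -> scalars R k) (e : 'I_d -> X) :
  p (\sum_i a i *: e i) <= \sum_i modulus (a i) * p (e i).
Proof.
elim/big_rec2: _ => [|i r y _ yr]; first by rewrite seminorm0.
by apply: le_trans (ler_seminormD hp _ _) _; rewrite (seminormZ hp) lerD2l.
Qed.

(** If e_0 could be approximated arbitrarily well by combinations of vectors
    whose coordinates are dominated by p, the coefficients would be Cauchy and
    the limit combination would be at p-distance 0 from e_0. *)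
Lemma seminorm_dist_gt0 d (e0 : X) (e : 'I_d -> X) (M : R) :
  (forall (a : 'I_d -> scalars R k) i,
     modulus (a i) <= M * p (\sum_i a i *: e i)) ->
  0 <= M ->
  (forall a : 'I_d -> scalars R k, p (e0 + \sum_i a i *: e i) != 0) ->
  exists2 delta, 0 < delta &
    forall a : 'I_d -> scalars R k, delta <= p (e0 + \sum_i a i *: e i).
Proof.
move=> eM M0 e0_indep; apply: contrapT => no_delta.
have approx n : exists a : 'I_d -> scalars R k,
    p (e0 + \sum_i a i *: e i) < n.+1%:R^-1.
  apply: contrapT => far; apply: no_delta; exists n.+1%:R^-1 => // a.
  by rewrite leNgt; apply/negP => near; apply: far; exists a.
have [u up] := choice approx.
have /choice[l ul] i : exists l, forall n,
    modulus (u n i - l) <= 2 * M * n.+1%:R^-1.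
  apply: (@modulus_complete _ _ (u ^~ i)) => n m.
  apply: (le_trans (eM (fun i => u n i - u m i) i)).
  apply: ler_wpM2l => //.
  have -> : \sum_i (u n i - u m i) *: e i =
      (e0 + \sum_i u n i *: e i) - (e0 + \sum_i u m i *: e i).
    rewrite opprD addrACA subrr add0r -sumrB.
    by apply: eq_bigr => j _; rewrite scalerBl.
  apply: le_trans (ler_seminormD hp _ _) _.
  by rewrite seminormN; apply: lerD; apply: ltW.
have /negP := e0_indep l; apply; rewrite eq_le seminorm_ge0 andbT.
apply: (@le0_of_le_harmonic _ _ (1 + \sum_i 2 * M * p (e i))) => n.
have -> : e0 + \sum_i l i *: e i =
    (e0 + \sum_i u n i *: e i) - \sum_i (u n i - l i) *: e i.
  rewrite -addrA -sumrB; congr (_ + _); apply: eq_bigr => j _.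
  by rewrite -scalerBl opprB addrC subrK.
apply: le_trans (ler_seminormD hp _ _) _.
rewrite seminormN mulrDl mul1r; apply: lerD; first exact: ltW.
apply: le_trans (ler_seminorm_sum _ _) _.
rewrite mulr_suml; apply: ler_sum => i _; rewrite mulrAC.
by apply: ler_wpM2r; [exact: seminorm_ge0 | exact: ul].
Qed.

(** Homogeneity turns the positive distance delta from e_0 to the span of the
    other vectors into the bound P / delta on the coefficient of e_0, where P is
    the seminorm of the whole combination.  The rest of the combination then has
    seminorm at most P + P / delta * p e_0, and induction applies to it. *)
Lemma coef_le_seminorm d (e : 'I_d -> X) :
  (forall a : 'I_d -> scalars R k,
     p (\sum_i a i *: e i) = 0 -> forall i, a i = 0) ->
  exists2 M : R, 0 < M & forall (a : 'I_d -> scalars R k) i,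
    modulus (a i) <= M * p (\sum_i a i *: e i).
Proof.
elim: d e => [|d IHd] e e_indep; first by exists 1 => // a [].
pose cons c (a : 'I_d -> scalars R k) i := oapp a c (unlift ord0 i).
have sum_cons c a : \sum_i cons c a i *: e i =
    c *: e ord0 + \sum_i a i *: e (lift ord0 i).
  rewrite big_ord_recl /cons unlift_none; congr (_ + _).
  by apply: eq_bigr => i _; rewrite liftK.
have [|M M0 eM] := IHd (fun i => e (lift ord0 i)).
  move=> a a0 i; have := e_indep (cons 0 a).
  rewrite sum_cons scale0r add0r => /(_ a0 (lift ord0 i)).
  by rewrite /cons liftK.
have [|delta delta0 e_far] := seminorm_dist_gt0 (e0 := e ord0) eM (ltW M0).
  move=> a; apply/eqP => a0; have := e_indep (cons 1 a).
  rewrite sum_cons scale1r => /(_ a0 ord0).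
  by rewrite /cons unlift_none => /eqP; rewrite oner_eq0.
exists (delta^-1 + M * (1 + delta^-1 * p (e ord0))).
  have := seminorm_ge0 (e ord0); move: delta0; rewrite -invr_gt0 => d0 pe0.
  by rewrite addr_gt0// mulr_gt0// ltr_wpDr// mulr_ge0// ltW.
move=> a i; rewrite big_ord_recl.
set w := \sum_(j < d) _; set P := p (_ + w).
have P0 : 0 <= P by exact: seminorm_ge0.
have head : modulus (a ord0) <= delta^-1 * P.
  have [->|a00] := eqVneq (a ord0) 0.
    by rewrite modulus0 mulr_ge0// invr_ge0 ltW.
  rewrite ler_pdivlMl// mulrC /P.
  have -> : a ord0 *: e ord0 + w = a ord0 *:
      (e ord0 + \sum_i ((a ord0)^-1 * a (lift ord0 i)) *: e (lift ord0 i)).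
    rewrite scalerDr scaler_sumr; congr (_ + _); apply: eq_bigr => j _.
    by rewrite scalerA mulrA mulfV// mul1r.
  by rewrite (seminormZ hp) ler_wpM2l ?modulus_ge0.
have pw : p w <= P + delta^-1 * P * p (e ord0).
  have -> : w = (a ord0 *: e ord0 + w) - a ord0 *: e ord0.
    by rewrite addrC addKr.
  apply: le_trans (ler_seminormD hp _ _) _.
  rewrite seminormN (seminormZ hp) lerD2l.
  by apply: ler_wpM2r => //; exact: seminorm_ge0.
have Mpw : 0 <= M * (P + delta^-1 * P * p (e ord0)).
  rewrite mulr_ge0 ?(ltW M0)// addr_ge0// mulr_ge0 ?seminorm_ge0//.
  by rewrite mulr_ge0// invr_ge0 ltW.
rewrite mulrDl -mulrA [(1 + _) * P]mulrDl mul1r [_ * _ * P]mulrAC.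
case: (unliftP ord0 i) => [j|] ->; last by rewrite ler_wpDr.
apply: (le_trans (eM (fun i => a (lift ord0 i)) j)).
rewrite ler_wpDl ?(ler_wpM2l (ltW M0))//.
by rewrite mulr_ge0// invr_ge0 ltW.
Qed.

End Seminorm.

(** * Weak convergence implies strong convergence *)

Section NNorm.
Context {R : realType} {k : scalar_kind} {X : vectType (scalars R k)} {m : nat}.
Variables (N : m.+1.-tuple X -> R) (b : m.-tuple X).
Hypothesis hN : is_nnorm N.

Let p (x : X) := N [tuple of x :: b].

Lemma nnorm_seminorm : is_seminorm p.
Proof. by split=> [a x|x y]; [exact: nnormZ hN _ _ _ | exact: ler_nnormD]. Qed.

Lemma nnorm_eq0_span x : free b -> p x = 0 <-> x \in <<b>>%VS.
Proof.
move=> bfree; rewrite /p (nnorm_eq0 hN) /= free_cons bfree andbT negbK.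
by split.
Qed.

(** Subtracting the projection onto the span of b is what makes this functional
    vanish on the null space of p, which any bounded functional must do. *)
Definition transverse_coord (i : 'I_(\dim <<b>>^C)) (z : bdomain b) :
    scalars R k :=
  coord (vbasis <<b>>^C) i (z.1 - projv <<b>> z.1).

Lemma transverse_decomp x :
  x = projv <<b>> x +
    \sum_i transverse_coord i (bpoint b x) *: (vbasis <<b>>^C)`_i.
Proof.
by rewrite /transverse_coord -coord_vbasis ?memv_projC// addrC subrK.
Qed.

Lemma transverse_coord_b_linear i : b_linear (transverse_coord i).
Proof.
split=> [x y|a x]; rewrite /transverse_coord /=.
  have -> : x + y - projv <<b>> (x + y) =
      (x - projv <<b>> x) + (y - projv <<b>> y).
    by rewrite linearD opprD addrACA.
  exact: linearD.
have -> : a *: x - projv <<b>> (a *: x) = a *: (x - projv <<b>> x).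
  by rewrite linearZ scalerBr.
exact: linearZ.
Qed.

(** On the complement of the span of b the seminorm p is a norm, so it dominates
    coordinates there; and removing the component along the span of b does not
    increase p, by the triangle inequality. *)
Lemma transverse_coord_b_bounded i : free b -> b_bounded N (transverse_coord i).
Proof.
move=> bfree; pose e (i : 'I_(\dim <<b>>^C)) := (vbasis <<b>>^C)`_i.
have [|M M0 eM] := coef_le_seminorm nnorm_seminorm (e := e).
  move=> a /(nnorm_eq0_span _ bfree) a0.
  have aC : \sum_i a i *: e i \in (<<b>>^C)%VS.
    apply: memv_suml => j _; apply: memvZ.
    by rewrite vbasis_mem// mem_nth// size_tuple.
  have : \sum_i a i *: e i = 0.
    by apply/eqP; rewrite -memv0 -(capv_compl <<b>>) memv_cap a0.
  by move/(freeP (basis_free (vbasisP _))).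
exists M => // x.
apply: (le_trans (eM (fun i => transverse_coord i (bpoint b x)) i)).
apply: ler_wpM2l; first exact: ltW.
have -> : \sum_i transverse_coord i (bpoint b x) *: e i = x - projv <<b>> x.
  by rewrite {2}[x]transverse_decomp addrC addKr.
apply: le_trans (ler_seminormD nnorm_seminorm _ _) _.
rewrite (seminormN nnorm_seminorm).
by rewrite ((nnorm_eq0_span (projv <<b>> x) bfree).2 (memv_proj _ _)) addr0.
Qed.

Lemma nnorm_le_transverse_coord x y : free b ->
  p (x - y) <= \sum_i
    modulus (transverse_coord i (bpoint b x) - transverse_coord i (bpoint b y)) *
    p (vbasis <<b>>^C)`_i.
Proof.
move=> bfree; set z := \sum_i _.
have -> : x - y = projv <<b>> (x - y) +
    \sum_i (transverse_coord i (bpoint b x) - transverse_coord i (bpoint b y)) *: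
      (vbasis <<b>>^C)`_i.
  rewrite linearB {1}[x]transverse_decomp {1}[y]transverse_decomp opprD addrACA.
  congr (_ + _); rewrite -sumrB; apply: eq_bigr => i _.
  by rewrite scalerBl.
apply: le_trans (ler_seminormD nnorm_seminorm _ _) _.
rewrite ((nnorm_eq0_span (projv <<b>> (x - y)) bfree).2 (memv_proj _ _)) add0r.
exact: ler_seminorm_sum nnorm_seminorm _ _ _.
Qed.

End NNorm.

Theorem theorem5p7 (R : realType) (k : scalar_kind) (X : vectType (scalars R k))
    (m : nat) (N : m.+1.-tuple X -> R) (b : m.-tuple X)
    (hdim : (m.+1 <= \dim {:X})%N) (hN : is_nnorm N)
    (x_ : nat -> X) (x : X) :
  b_weak_cvg N b x_ x -> b_strong_cvg N b x_ x.
Proof.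
move=> weak; rewrite /b_strong_cvg.
have [bfree|/negbTE bdep] := boolP (free b); last first.
  under eq_fun do rewrite (nnorm_eq0 hN _).2 ?free_cons ?bdep ?andbF//.
  exact: cvg_cst.
pose D i j := modulus (transverse_coord i (bpoint b (x_ j)) -
                       transverse_coord i (bpoint b x)).
pose E i := N [tuple of (vbasis <<b>>^C)`_i :: b].
apply: (squeeze_cvgr (f := fun=> 0) (h := fun j => \sum_i D i j * E i)).
- apply: nearW => j; apply/andP; split.
    exact: (seminorm_ge0 (nnorm_seminorm b hN)).
  exact: nnorm_le_transverse_coord.
- exact: cvg_cst.
- rewrite [X in _ --> X](_ : 0 = \sum_(i < \dim <<b>>^C) 0 * E i); last first.
    by rewrite big1// => i _; rewrite mul0r.
  apply: (cvg_big (P := xpredT) (op := +%R)) => [|i _].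
    exact: add_continuous.
  apply: cvgM; last exact: cvg_cst.
  apply: cvg_modulus.
  apply: weak; split; first exact: transverse_coord_b_linear.
  exact: transverse_coord_b_bounded.
Qed.
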